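(* Let $G$ be a group with finite abelianisation. Then $\mathcal{DP}(G,\mathrm{ab})$ is reducible to the Diophantine Problem in $G$ with recognisable constraints.
   Context: **Equations.** Let $G$ be a group with a finite symmetric generating set $S$. A finite system of equations in $G$ over variables $\mathbf{x}=\{X_1,\dots,X_k\}$ is a finite subset $\mathcal{E}=\{w_1,\dots,w_n\}$ of the free product $G\ast F(\mathbf{x})$; constants from $G$ are given as words over $S$. A solution is a homomorphism $\phi:G\ast F(\mathbf{x})\to G$ which is the identity on $G$ and satisfies $\phi(w_1)=\dots=\phi(w_n)=1$. **Recognisable constraints.** Let $\pi:S^*\to G$ be the natural projection from the free monoid on $S$. A subset $L\subseteq G$ is recognisable if the full preimage $\pi^{-1}(L)$ is a regular language over $S$ (equivalently, $L$ is a union of cosets of a finite index subgroup). The Diophantine Problem with recognisable constraints asks, given a finite system of equations in $G$ and, for some of the variables, recognisable sets (given by finite automata for their preimages), whether the system has a solution in which these variables take values in their specified sets. **The problem $\mathcal{DP}(G,\mathrm{ab})$.** Let $\mathrm{ab}:G\to G^{\mathrm{ab}}=G/G'$ be the abelianisation map. An instance consists of a finite system $\mathcal{E}$ of equations in $G$ on variables $X_1,\dots,X_k$ and a finite system $\Theta$ of equations in the group $G^{\mathrm{ab}}$ on the same variables; the question is whether $\mathcal{E}$ has a solution $(g_1,\dots,g_k)\in G^k$ such that $(\mathrm{ab}(g_1),\dots,\mathrm{ab}(g_k))$ satisfies $\Theta$. ''Reducible'' means algorithmically reducible: an algorithm solving the second problem yields an algorithm solving the first. *)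

(* Defs.v *)
From HB Require Import structures.
From mathcomp Require Import all_boot finmap.
From mathcomp Require Import boolp classical_sets functions cardinality.

Set Implicit Arguments.
Unset Strict Implicit.
Unset Printing Implicit Defensive.

Local Open Scope classical_set_scope.
Local Open Scope group_scope.
Local Open Scope quotient_scope.

Section Subgroups.
Variable G : groupType.

Definition is_subgroup (H : set G) : Prop :=
  [/\ H 1, forall x y, H x -> H y -> H (x * y) & forall x, H x -> H x^-1].

Definition generated_subgroup (A : set G) : set G := smallest is_subgroup A.

Definition derived_subgroup : set G :=
  generated_subgroup [set [~ x, y] | x in setT & y in setT].

Lemma is_subgroup_generated (A : set G) : is_subgroup (generated_subgroup A).
Proof.
split=> [H [[H1 _ _] _] //|x y Hx Hy H HP|x Hx H HP].
- by have [[_ HM _] _] := HP; apply: HM; [exact: Hx|exact: Hy].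
- by have [[_ _ HV] _] := HP; apply: HV; exact: Hx.
Qed.

Lemma derived_conj (x y : G) :
  derived_subgroup x -> derived_subgroup (x ^ y).
Proof.
have [_ HM _] := is_subgroup_generated [set [~ x, y] | x in setT & y in setT].
move=> Hx; have -> : x ^ y = x * [~ x, y] by rewrite /commg mulVKg.
by apply: HM => // H [_]; apply; exists x => //; exists y.
Qed.

End Subgroups.

(* The abelianisation is the quotient of [G] by its derived subgroup. *)
Section Abelianisation.
Variable G : groupType.

Definition derived_coset (x y : G) : bool := `[< derived_subgroup (x^-1 * y) >].

Let derP := is_subgroup_generated [set [~ x, y : G] | x in setT & y in setT].

Lemma derived_coset_refl : reflexive derived_coset.
Proof. by move=> x; apply/asboolP; rewrite mulVg; have [] := derP. Qed.

Lemma derived_coset_sym : symmetric derived_coset.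
Proof.
suff D x y : derived_coset x y -> derived_coset y x.
  by move=> x y; apply/idP/idP; exact: D.
move=> /asboolP Hxy; apply/asboolP; have [_ _ HV] := derP.
by rewrite -[_ * _]invgK invgM invgK; exact: HV.
Qed.

Lemma derived_coset_trans : transitive derived_coset.
Proof.
move=> y x z /asboolP Hxy /asboolP Hyz; apply/asboolP; have [_ HM _] := derP.
by have := HM _ _ Hxy Hyz; rewrite mulgA mulgK.
Qed.

Canonical derived_coset_equiv : equiv_rel G :=
  EquivRel derived_coset derived_coset_refl derived_coset_sym
    derived_coset_trans.

Definition abelianisation : Type := {eq_quot derived_coset}.
HB.instance Definition _ : EqQuotient _ derived_coset abelianisation :=
  EqQuotient.on abelianisation.
HB.instance Definition _ := Choice.on abelianisation.

Definition ab (g : G) : abelianisation := \pi_abelianisation g.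

Definition ab_one : abelianisation := ab 1.
Definition ab_mul (x y : abelianisation) : abelianisation :=
  ab (repr x * repr y).
Definition ab_inv (x : abelianisation) : abelianisation := ab (repr x)^-1.

Lemma ab_eqP (x y : G) : ab x = ab y <-> derived_coset x y.
Proof. by split=> [/eqmodP|H]; last exact/eqmodP. Qed.

Lemma ab_repr (x : abelianisation) : ab (repr x) = x.
Proof. exact: reprK. Qed.

Lemma repr_ab (x : G) : derived_coset (repr (ab x)) x.
Proof. by apply/ab_eqP; rewrite ab_repr. Qed.

Lemma ab_mulE (x y : G) : ab_mul (ab x) (ab y) = ab (x * y).
Proof.
apply/ab_eqP/asboolP; move: (repr_ab x) (repr_ab y) => /asboolP Hx /asboolP Hy.
have [_ HM _] := derP; set x' := repr _ in Hx *; set y' := repr _ in Hy *.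
have -> : (x' * y')^-1 * (x * y) = (x'^-1 * x) ^ y' * (y'^-1 * y).
  by rewrite /conjg invgM !mulgA mulgK.
by apply: HM => //; exact: derived_conj.
Qed.

Lemma ab_invE (x : G) : ab_inv (ab x) = ab x^-1.
Proof.
apply/ab_eqP/asboolP; move: (repr_ab x); rewrite derived_coset_sym.
move=> /asboolP Hx; set x' := repr _ in Hx *.
have -> : (x'^-1)^-1 * x^-1 = (x^-1 * x') ^ x^-1.
  by rewrite /conjg !invgK !mulgA mulgV mul1g.
exact: derived_conj.
Qed.

Lemma ab_mulA : associative ab_mul.
Proof.
by move=> x y z; rewrite -(ab_repr x) -(ab_repr y) -(ab_repr z) !ab_mulE mulgA.
Qed.

Lemma ab_mul1 : left_id ab_one ab_mul.
Proof. by move=> x; rewrite -(ab_repr x) ab_mulE mul1g. Qed.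

Lemma ab_1mul : right_id ab_one ab_mul.
Proof. by move=> x; rewrite -(ab_repr x) ab_mulE mulg1. Qed.

Lemma ab_mulV : left_inverse ab_one ab_inv ab_mul.
Proof. by move=> x; rewrite -(ab_repr x) ab_invE ab_mulE mulVg. Qed.

Lemma ab_Vmul : right_inverse ab_one ab_inv ab_mul.
Proof. by move=> x; rewrite -(ab_repr x) ab_invE ab_mulE mulgV. Qed.

HB.instance Definition _ := isGroup.Build abelianisation
  ab_mulA ab_mul1 ab_1mul ab_mulV ab_Vmul.

Lemma abM : {morph ab : x y / x * y}.
Proof. by move=> x y; rewrite -ab_mulE. Qed.

HB.instance Definition _ := isMultiplicative.Build G abelianisation ab abM.

End Abelianisation.

(* The free product of [G] with the free group on [X_0, ..., X_(k-1)], as a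
   quotient of the monoid of words. *)
Section FreeProduct.
Variables (G : groupType) (k : nat).

(* [inr (i, false)] stands for X_i and [inr (i, true)] for its inverse *)
Definition syllable : Type := (G + 'I_k * bool)%type.

Inductive fp_cong : seq syllable -> seq syllable -> Prop :=
| fp_cong_refl u : fp_cong u u
| fp_cong_sym u v : fp_cong u v -> fp_cong v u
| fp_cong_trans u v w : fp_cong u v -> fp_cong v w -> fp_cong u w
| fp_cong_cat u u' v v' :
    fp_cong u u' -> fp_cong v v' -> fp_cong (u ++ v) (u' ++ v')
| fp_cong_one : fp_cong [:: inl 1] [::]
| fp_cong_mul g h : fp_cong [:: inl g; inl h] [:: inl (g * h)]
| fp_cong_var i b : fp_cong [:: inr (i, b); inr (i, ~~ b)] [::].

Definition fp_congb (u v : seq syllable) : bool := `[< fp_cong u v >].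

Lemma fp_congb_refl : reflexive fp_congb.
Proof. by move=> u; apply/asboolP; exact: fp_cong_refl. Qed.

Lemma fp_congb_sym : symmetric fp_congb.
Proof. by move=> u v; apply/asboolP/asboolP; exact: fp_cong_sym. Qed.

Lemma fp_congb_trans : transitive fp_congb.
Proof.
by move=> v u w /asboolP uv /asboolP vw; apply/asboolP; exact: fp_cong_trans vw.
Qed.

Canonical fp_congb_equiv : equiv_rel (seq syllable) :=
  EquivRel fp_congb fp_congb_refl fp_congb_sym fp_congb_trans.

Definition free_product : Type := {eq_quot fp_congb}.
HB.instance Definition _ : EqQuotient _ fp_congb free_product :=
  EqQuotient.on free_product.
HB.instance Definition _ := Choice.on free_product.

Definition fp_pi (u : seq syllable) : free_product := \pi_free_product u.

Definition syllable_inv (x : syllable) : syllable :=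
  match x with inl g => inl g^-1 | inr (i, b) => inr (i, ~~ b) end.

Definition fp_one : free_product := fp_pi [::].
Definition fp_mul (x y : free_product) : free_product :=
  fp_pi (repr x ++ repr y).
Definition fp_inv (x : free_product) : free_product :=
  fp_pi (rev (map syllable_inv (repr x))).

Lemma fp_piP u v : fp_pi u = fp_pi v <-> fp_cong u v.
Proof.
split=> [/eqmodP /asboolP //|H].
by apply/eqmodP/asboolP.
Qed.

Lemma fp_repr (x : free_product) : fp_pi (repr x) = x.
Proof. exact: reprK. Qed.

Lemma repr_fp u : fp_cong (repr (fp_pi u)) u.
Proof. by apply/fp_piP; rewrite fp_repr. Qed.

Lemma fp_mulE u v : fp_mul (fp_pi u) (fp_pi v) = fp_pi (u ++ v).
Proof. by apply/fp_piP; apply: fp_cong_cat; exact: repr_fp. Qed.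

Lemma syllable_inv_cong u v : fp_cong u v ->
  fp_cong (rev (map syllable_inv u)) (rev (map syllable_inv v)).
Proof.
elim=> {u v} [u|u v _|u v w _ IH1 _ IH2|u u' v v' _ IH1 _ IH2||g h|i b] /=.
- exact: fp_cong_refl.
- exact: fp_cong_sym.
- exact: fp_cong_trans IH1 IH2.
- by rewrite !map_cat !rev_cat; exact: fp_cong_cat.
- by rewrite /rev /= invg1; exact: fp_cong_one.
- by rewrite /rev /= invgM; exact: fp_cong_mul.
- by rewrite /rev /= negbK; exact: fp_cong_var.
Qed.

Lemma fp_invE u : fp_inv (fp_pi u) = fp_pi (rev (map syllable_inv u)).
Proof. by apply/fp_piP; apply: syllable_inv_cong; exact: repr_fp. Qed.

Lemma syllable_invK : involutive syllable_inv.
Proof. by case=> [g|[i b]] /=; rewrite ?invgK ?negbK. Qed.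

Lemma fp_congV u : fp_cong (rev (map syllable_inv u) ++ u) [::].
Proof.
elim: u => [|x u IH] /=; first exact: fp_cong_refl.
rewrite rev_cons -cats1 -catA; apply: fp_cong_trans IH.
apply: fp_cong_cat; first exact: fp_cong_refl.
rewrite -[x :: u]/([:: x] ++ u) catA -[u in X in fp_cong _ X]cat0s.
apply: fp_cong_cat; last exact: fp_cong_refl.
case: x => [g|[i b]] /=; last by rewrite -{2}[b]negbK; exact: fp_cong_var.
apply: fp_cong_trans (fp_cong_mul _ _) _; rewrite mulVg; exact: fp_cong_one.
Qed.

Lemma fp_mulA : associative fp_mul.
Proof.
by move=> x y z; rewrite -(fp_repr x) -(fp_repr y) -(fp_repr z) !fp_mulE catA.
Qed.

Lemma fp_mul1 : left_id fp_one fp_mul.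
Proof. by move=> x; rewrite -(fp_repr x) fp_mulE. Qed.

Lemma fp_1mul : right_id fp_one fp_mul.
Proof. by move=> x; rewrite -(fp_repr x) fp_mulE cats0. Qed.

Lemma fp_mulV : left_inverse fp_one fp_inv fp_mul.
Proof.
move=> x; rewrite -(fp_repr x) fp_invE fp_mulE; apply/fp_piP; exact: fp_congV.
Qed.

Lemma fp_Vmul : right_inverse fp_one fp_inv fp_mul.
Proof.
move=> x; rewrite -(fp_repr x) fp_invE fp_mulE; apply/fp_piP.
have := fp_congV (rev (map syllable_inv (repr x))).
by rewrite map_rev revK (mapK syllable_invK).
Qed.

HB.instance Definition _ := isGroup.Build free_product
  fp_mulA fp_mul1 fp_1mul fp_mulV fp_Vmul.

Definition fp_const (g : G) : free_product := fp_pi [:: inl g].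
Definition fp_var (i : 'I_k) : free_product := fp_pi [:: inr (i, false)].

End FreeProduct.

Arguments fp_const {G} k g.
Arguments fp_var G {k} i.

Section FreeProductLift.
Variables (G H : groupType) (k : nat).
Variables (f : {multiplicative G -> H}) (h : 'I_k -> H).

Definition fp_eval (u : seq (syllable G k)) : H :=
  \prod_(l <- u)
    match l with inl g => f g | inr (i, b) => if b then (h i)^-1 else h i end.

Lemma fp_eval_cong u v : fp_cong u v -> fp_eval u = fp_eval v.
Proof.
have f1 : f 1 = 1 by apply: (mulgI (f 1)); rewrite -gmulfM !mulg1.
elim=> {u v} [//|u v _ -> //|u v w _ -> _ -> //|u u' v v' _ IH1 _ IH2||g g'|i b].
- by rewrite /fp_eval !big_cat /=; congr mul.
- by rewrite /fp_eval big_seq1 big_nil.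
- by rewrite /fp_eval big_cons !big_seq1 gmulfM.
- rewrite /fp_eval big_cons big_seq1 big_nil.
  by case: b => /=; rewrite ?mulVg ?mulgV.
Qed.

Definition fp_lift (x : free_product G k) : H := fp_eval (repr x).

Lemma fp_lift_pi u : fp_lift (fp_pi u) = fp_eval u.
Proof. by apply: fp_eval_cong; exact: repr_fp. Qed.

Lemma fp_liftM : {morph fp_lift : x y / x * y}.
Proof.
move=> x y; rewrite -(fp_repr x) -(fp_repr y) [_ * _]fp_mulE !fp_lift_pi.
by rewrite /fp_eval big_cat.
Qed.

HB.instance Definition _ :=
  isMultiplicative.Build (free_product G k) H fp_lift fp_liftM.

Lemma fp_lift_const g : fp_lift (fp_const k g) = f g.
Proof. by rewrite fp_lift_pi /fp_eval big_seq1. Qed.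

Lemma fp_lift_var i : fp_lift (fp_var G i) = h i.
Proof. by rewrite fp_lift_pi /fp_eval big_seq1. Qed.

End FreeProductLift.

(* Homomorphisms [G * F(X) -> G] over [G], identified with the tuples of the
   images of the variables. *)
Definition is_solution (G : groupType) (k : nat)
    (E : seq (free_product G k)) (g : 'I_k -> G) : Prop :=
  exists phi : {multiplicative free_product G k -> G},
    [/\ forall c, phi (fp_const k c) = c,
        forall i, phi (fp_var G i) = g i
      & forall w, w \in E -> phi w = 1].

Section Words.
Variables (G : groupType) (S : {fset G}).

Definition word_proj (w : seq S) : G := \prod_(s <- w) val s.

Definition eqn_word (k : nat) : Type := seq (S + 'I_k * bool).

(* The element of [H * F(X)] represented by a word, when the letter [s : S]
   stands for [c s : H]. *)
Definition eqn_of_word (H : groupType) (c : S -> H) (k : nat)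
    (w : eqn_word k) : free_product H k :=
  \prod_(l <- w)
    match l with
    | inl s => fp_const k (c s)
    | inr (i, b) => if b then (fp_var H i)^-1 else fp_var H i
    end.

End Words.

Record dfa (A : finType) := Dfa {
  dfa_size : nat;
  dfa_start : 'I_dfa_size;
  dfa_final : pred 'I_dfa_size;
  dfa_step : 'I_dfa_size -> A -> 'I_dfa_size }.

Definition dfa_lang (A : finType) (M : dfa A) : set (seq A) :=
  [set w | dfa_final (foldl (@dfa_step A M) (dfa_start M) w)].

Definition recognises (G : groupType) (S : {fset G}) (M : dfa S)
    (L : set G) : Prop :=
  @word_proj G S @^-1` L = dfa_lang M.

(* Algorithms are programs of the language WHILE of N. D. Jones
   (Computability and Complexity, 1997), which computes on binary trees;
   it is extended by an oracle query for relative computability. *)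

Inductive tree : Type := Leaf | Node of tree & tree.

Fixpoint tree_eqb (t u : tree) : bool :=
  match t, u with
  | Leaf, Leaf => true
  | Node t1 t2, Node u1 u2 => tree_eqb t1 u1 && tree_eqb t2 u2
  | _, _ => false
  end.

Definition tree_head (t : tree) : tree := if t is Node u _ then u else Leaf.
Definition tree_tail (t : tree) : tree := if t is Node _ u then u else Leaf.

Definition code_bool (b : bool) : tree := if b then Node Leaf Leaf else Leaf.

Inductive expr : Type :=
| EVar of nat
| EConst of tree
| ECons of expr & expr
| EHead of expr
| ETail of expr
| EEq of expr & expr.

Inductive cmd : Type :=
| CSkip
| CAssign of nat & expr
| CSeq of cmd & cmd
| CIf of expr & cmd & cmd
| CWhile of expr & cmd
| CQuery of nat & expr.

Definition store : Type := nat -> tree.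

Definition update (st : store) (x : nat) (t : tree) : store :=
  fun y => if y == x then t else st y.

Fixpoint eval (st : store) (e : expr) : tree :=
  match e with
  | EVar x => st x
  | EConst t => t
  | ECons e1 e2 => Node (eval st e1) (eval st e2)
  | EHead e1 => tree_head (eval st e1)
  | ETail e1 => tree_tail (eval st e1)
  | EEq e1 e2 => code_bool (tree_eqb (eval st e1) (eval st e2))
  end.

(* [None] means that the oracle does not answer: such a query never returns. *)
Definition oracle : Type := tree -> option bool.

Inductive exec (O : oracle) : cmd -> store -> store -> Prop :=
| exec_skip st : exec O CSkip st st
| exec_assign x e st : exec O (CAssign x e) st (update st x (eval st e))
| exec_seq c1 c2 st st' st'' :
    exec O c1 st st' -> exec O c2 st' st'' -> exec O (CSeq c1 c2) st st''
| exec_if_true e c1 c2 st st' :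
    eval st e <> Leaf -> exec O c1 st st' -> exec O (CIf e c1 c2) st st'
| exec_if_false e c1 c2 st st' :
    eval st e = Leaf -> exec O c2 st st' -> exec O (CIf e c1 c2) st st'
| exec_while_true e c st st' st'' :
    eval st e <> Leaf -> exec O c st st' -> exec O (CWhile e c) st' st'' ->
    exec O (CWhile e c) st st''
| exec_while_false e c st :
    eval st e = Leaf -> exec O (CWhile e c) st st
| exec_query x e b st :
    O (eval st e) = Some b ->
    exec O (CQuery x e) st (update st x (code_bool b)).

(* Input and output are in variable 0; all other variables start as [Leaf]. *)
Definition computes (O : oracle) (p : cmd) (input output : tree) : Prop :=
  exists2 st, exec O p (update (fun=> Leaf) 0 input) st & st 0 = output.

(* A decision problem whose instances may carry a promise. *)
Record problem := Problem {
  instance : Type;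
  promise : instance -> Prop;
  answer : instance -> Prop;
  code : instance -> tree }.

(* Nothing is required of an oracle outside the promise. *)
Definition oracle_solves (O : oracle) (P : problem) : Prop :=
  forall I : instance P, promise I ->
    exists2 b, O (code I) = Some b & (b <-> answer I).

Definition program_solves (O : oracle) (p : cmd) (P : problem) : Prop :=
  forall I : instance P, promise I ->
    exists2 b, computes O p (code I) (code_bool b) & (b <-> answer I).

(* Turing reducibility: the same program works for every oracle. *)
Definition reducible (P Q : problem) : Prop :=
  exists p : cmd, forall O : oracle, oracle_solves O Q -> program_solves O p P.

Definition code_nat (n : nat) : tree := iter n (Node Leaf) Leaf.

Definition code_seq (A : Type) (f : A -> tree) (s : seq A) : tree :=
  foldr (fun x t => Node (f x) t) Leaf s.

Definition code_option (A : Type) (f : A -> tree) (x : option A) : tree :=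
  if x is Some a then Node Leaf (f a) else Leaf.

Definition code_ord (n : nat) (i : 'I_n) : tree := code_nat i.

Definition code_eqn (G : groupType) (S : {fset G}) (k : nat) :
    eqn_word S k -> tree :=
  code_seq (fun l =>
    match l with
    | inl s => Node (code_bool false) (code_ord (enum_rank s))
    | inr (i, b) => Node (code_bool true) (Node (code_bool b) (code_ord i))
    end).

Definition code_dfa (A : finType) (M : dfa A) : tree :=
  Node (code_nat (dfa_size M))
    (Node (code_ord (dfa_start M))
      (Node (code_seq (fun q => code_bool (dfa_final q)) (enum 'I_(dfa_size M)))
        (code_seq (fun q => code_seq (fun a => code_ord (dfa_step q a)) (enum A))
          (enum 'I_(dfa_size M))))).

Section Problems.
Variables (G : groupType) (S : {fset G}).

Record ab_instance := AbInstance {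
  ab_vars : nat;
  ab_eqns : seq (eqn_word S ab_vars);
  ab_theta : seq (eqn_word S ab_vars) }.

Definition ab_answer (I : ab_instance) : Prop :=
  exists2 g : 'I_(ab_vars I) -> G,
    is_solution [seq eqn_of_word val w | w <- ab_eqns I] g &
    is_solution [seq eqn_of_word (fun s => ab (val s)) w | w <- ab_theta I]
      (fun i => ab (g i)).

Definition code_ab_instance (I : ab_instance) : tree :=
  Node (code_nat (ab_vars I))
    (Node (code_seq (@code_eqn G S _) (ab_eqns I))
      (code_seq (@code_eqn G S _) (ab_theta I))).

Definition DP_ab : problem := {|
  instance := ab_instance;
  promise := fun=> True;
  answer := ab_answer;
  code := code_ab_instance |}.

(* [None] in [rec_constraints] leaves the corresponding variable free. *)
Record rec_instance := RecInstance {
  rec_vars : nat;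
  rec_eqns : seq (eqn_word S rec_vars);
  rec_constraints : rec_vars.-tuple (option (dfa S)) }.

(* Every automaton does accept the full preimage of some subset of [G]. *)
Definition rec_promise (I : rec_instance) : Prop :=
  forall i M, tnth (rec_constraints I) i = Some M ->
    exists L : set G, recognises M L.

Definition rec_answer (I : rec_instance) : Prop :=
  exists2 g : 'I_(rec_vars I) -> G,
    is_solution [seq eqn_of_word val w | w <- rec_eqns I] g &
    forall i M, tnth (rec_constraints I) i = Some M ->
      exists2 L : set G, recognises M L & L (g i).

Definition code_rec_instance (I : rec_instance) : tree :=
  Node (code_nat (rec_vars I))
    (Node (code_seq (@code_eqn G S _) (rec_eqns I))
      (code_seq (code_option (@code_dfa S)) (rec_constraints I))).

Definition DP_rec : problem := {|
  instance := rec_instance;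
  promise := rec_promise;
  answer := rec_answer;
  code := code_rec_instance |}.

End Problems.

(* Main.v *)
Require Import Defs.
From mathcomp Require Import all_boot finmap.
From mathcomp Require Import boolp classical_sets functions cardinality.

(** A system [Theta] over the abelianisation is a system over [G] up to
    elements of [G']: a word [theta_j] is trivial in the abelianisation iff
    [Y_j^-1 theta_j = 1] is solvable in [G] with [Y_j] in [G'].  As [G'] has
    finite index, it is recognisable, by the automaton of the finite group
    [G / G']; a single query with one new variable [Y_j] for each equation of
    [Theta] therefore suffices. *)

Set Implicit Arguments.
Unset Strict Implicit.
Unset Printing Implicit Defensive.

Local Open Scope classical_set_scope.
Local Open Scope group_scope.

(** * Values of equation words in a group *)

Section WordValues.
Variables (G : groupType) (S : {fset G}).

Definition word_value (H : groupType) (c : S -> H) (k : nat) (g : 'I_k -> H)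
    (w : eqn_word S k) : H :=
  \prod_(l <- w)
    match l with
    | inl s => c s
    | inr (i, b) => if b then (g i)^-1 else g i
    end.

Lemma multiplicative_eqn_of_word (H : groupType) (c : S -> H) (k : nat)
    (g : 'I_k -> H) (phi : {multiplicative free_product H k -> H}) :
  (forall x, phi (fp_const k x) = x) -> (forall i, phi (fp_var H i) = g i) ->
  forall w, phi (eqn_of_word c w) = word_value c g w.
Proof.
move=> phic phiv w.
have phi1 : phi 1 = 1 by apply: (mulgI (phi 1)); rewrite -gmulfM !mulg1.
have phiV x : phi x^-1 = (phi x)^-1.
  by apply: (mulgI (phi x)); rewrite -gmulfM !mulgV.
rewrite /eqn_of_word /word_value; elim: w => [|l w IH].
  by rewrite !big_nil.
rewrite !big_cons gmulfM IH; congr (_ * _).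
by case: l => [s|[i []]]; rewrite ?phiV ?phic ?phiv.
Qed.

(** By the universal property of the free product, homomorphisms over [H] amount to assignments of
    the variables, so from here on only word values matter. *)
Lemma is_solutionP (H : groupType) (c : S -> H) (k : nat)
    (E : seq (eqn_word S k)) (g : 'I_k -> H) :
  is_solution [seq eqn_of_word c w | w <- E] g <->
  forall w, w \in E -> word_value c g w = 1.
Proof.
split=> [[phi [phic phiv phiE]] w wE|gE].
  rewrite -(multiplicative_eqn_of_word c phic phiv).
  by apply: phiE; apply/mapP; exists w.
pose phi : {multiplicative free_product H k -> H} := fp_lift idfun g.
have phic x : phi (fp_const k x) = x by rewrite /phi /= fp_lift_const.
have phiv i : phi (fp_var H i) = g i by rewrite /phi /= fp_lift_var.
exists phi; split=> // _ /mapP[w wE ->].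
by rewrite (multiplicative_eqn_of_word c phic phiv) gE.
Qed.

(** The constants of [Theta] are words over [S], so each of its words can also be evaluated in [G];
    [ab] is a homomorphism and relates the two values. *)
Lemma ab_word_value (k : nat) (g : 'I_k -> G) (w : eqn_word S k) :
  word_value (fun s : S => ab (val s)) (fun i => ab (g i)) w =
  ab (word_value (fun s : S => val s) g w).
Proof.
rewrite /word_value; elim: w => [|l w IH]; first by rewrite !big_nil.
rewrite !big_cons abM IH; congr (_ * _).
by case: l => [s|[i []]] //; rewrite -ab_invE.
Qed.

Definition rename_word (k k' : nat) (r : 'I_k -> 'I_k') (w : eqn_word S k) :
    eqn_word S k' :=
  map (fun l => match l with
                | inl s => inl s
                | inr (i, b) => inr (r i, b)
                end) w.

Lemma word_value_rename (H : groupType) (c : S -> H) (k k' : nat)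
    (r : 'I_k -> 'I_k') (g : 'I_k' -> H) (w : eqn_word S k) :
  word_value c g (rename_word r w) = word_value c (g \o r) w.
Proof. by rewrite /word_value big_map; apply: eq_bigr => -[s|[i b]] _. Qed.

(** A variable is coded by its number alone, so a program can copy old equations unchanged into a
    system with more variables. *)
Lemma code_eqn_rename (k k' : nat) (r : 'I_k -> 'I_k') (w : eqn_word S k) :
  (forall i, r i = i :> nat) -> code_eqn (rename_word r w) = code_eqn w.
Proof.
move=> rE; rewrite /code_eqn; elim: w => //= l w ->.
by case: l => [s|[i b]] //; rewrite /code_ord rE.
Qed.

End WordValues.

(** * The automaton of the finite abelianisation *)

Section DerivedAutomaton.
Variables (G : groupType) (S : {fset G}).

(** The values of words form a subgroup containing [S]; symmetry of [S] provides the inverses, read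
    off letter by letter in reverse. *)
Lemma word_proj_surj :
  (forall s, s \in S -> s^-1 \in S) ->
  generated_subgroup [set` S] = [set: G] ->
  forall x, exists w, @word_proj G S w = x.
Proof.
move=> SV Sgen x.
have : generated_subgroup [set` S] x by rewrite Sgen.
move/(_ [set y | exists w, word_proj w = y]); apply; split; last first.
  by move=> s /= sS; exists [:: FSetSub sS]; rewrite /word_proj big_seq1.
split=> [|_ _ [u <-] [v <-]|_ [u <-]].
- by exists [::]; rewrite /word_proj big_nil.
- by exists (u ++ v); rewrite /word_proj big_cat.
- elim: u => [|s u [v vE]].
    by exists [::]; rewrite /word_proj big_nil invg1.
  exists (rcons v (FSetSub (SV _ (valP s)))).
  by rewrite /word_proj big_rcons big_cons /= invgM -vE.
Qed.

Hypothesis ab_finite : finite_set [set: abelianisation G].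

Let Q : {fset abelianisation G} := fset_set [set: abelianisation G].

Let memQ (a : abelianisation G) : a \in Q.
Proof. by rewrite in_fset_set // inE. Qed.

Let state (a : abelianisation G) : 'I_#|{: Q}| := enum_rank (FSetSub (memQ a)).

Let stateK : cancel state (fun q => val (enum_val q)).
Proof. by move=> a; rewrite enum_rankK. Qed.

(** This is the Cayley graph of the abelianisation, with the identity as initial and only final
    state. *)
Definition derived_dfa : dfa S :=
  @Dfa S #|{: Q}| (state 1) (fun q => val (enum_val q) == 1)
    (fun q s => state (val (enum_val q) * ab (val s))).

Lemma derived_dfa_recognises : recognises derived_dfa [set x | ab x = 1].
Proof.
rewrite /recognises /dfa_lang; apply/seteqP.
(* The initial state is generalised to any [a], as it changes along the induction on [w]. *)
have run w a : foldl (@dfa_step _ derived_dfa) (state a) w =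
    state (a * ab (word_proj w)).
  elim: w a => [|s w IH] a /=; rewrite /word_proj.
    by rewrite big_nil (mulg1 a).
  by rewrite stateK IH big_cons abM mulgA.
by split=> w /=; rewrite run stateK mul1g => /eqP.
Qed.

End DerivedAutomaton.

(** * Translation of instances and its correctness *)

Section Reduction.
Variables (G : groupType) (S : {fset G}) (M : dfa S).

(** The new variables are numbered after the old ones, which keep their numbers; the inverse stands
    at the head so that one cons produces its code. *)
Definition witnessed_eqn (I : ab_instance S) (j : 'I_(size (ab_theta I))) :
    eqn_word S (ab_vars I + size (ab_theta I)) :=
  inr (rshift (ab_vars I) j, true) ::
    rename_word (lshift _) (tnth (in_tuple (ab_theta I)) j).

(* The new equations are in reverse order, as the program pushes them one by
   one. *)
Definition rec_instance_of (I : ab_instance S) : rec_instance S :=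
  @RecInstance G S (ab_vars I + size (ab_theta I))
    (rev [seq witnessed_eqn j | j <- enum 'I_(size (ab_theta I))] ++
       [seq rename_word (lshift _) w | w <- ab_eqns I])
    [tuple of nseq (ab_vars I) None ++ nseq (size (ab_theta I)) (Some M)].

Lemma rec_instance_lshift I (i : 'I_(ab_vars I)) :
  tnth (rec_constraints (rec_instance_of I)) (lshift _ i) = None.
Proof. by rewrite tnth_lshift (tnth_nth None) nth_nseq if_same. Qed.

Lemma rec_instance_rshift I (j : 'I_(size (ab_theta I))) :
  tnth (rec_constraints (rec_instance_of I)) (rshift _ j) = Some M.
Proof. by rewrite tnth_rshift (tnth_nth None) nth_nseq ltn_ord. Qed.

Lemma rec_instance_constraint I i N :
  tnth (rec_constraints (rec_instance_of I)) i = Some N -> N = M.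
Proof.
case: (split_ordP i) => j ->; first by rewrite rec_instance_lshift.
by rewrite rec_instance_rshift => -[].
Qed.

Lemma witnessed_eqn_value I (g : 'I_(ab_vars I + size (ab_theta I)) -> G) j :
  word_value (fun s : S => val s) g (@witnessed_eqn I j) =
  (g (rshift _ j))^-1 *
    word_value (fun s : S => val s) (g \o lshift _)
      (tnth (in_tuple (ab_theta I)) j).
Proof. by rewrite -word_value_rename /word_value big_cons. Qed.

Hypothesis M_derived : recognises M [set x | ab x = 1].
Hypothesis S_surj : forall x, exists w, @word_proj G S w = x.

(** As every element is the value of a word, the language of [M] determines the set it recognises;
    an answer only supplies some such [L]. *)
Lemma recognised_derived (L : set G) x : recognises M L -> L x -> ab x = 1.
Proof.
have [w <-] := S_surj x => ML Lw.
have : (@word_proj G S @^-1` L) w by [].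
by rewrite ML -M_derived.
Qed.

Lemma rec_instance_of_promise I : rec_promise (rec_instance_of I).
Proof. by move=> i N /rec_instance_constraint ->; exists [set x | ab x = 1]. Qed.

Lemma rec_instance_of_answer I : rec_answer (rec_instance_of I) <-> ab_answer I.
Proof.
split=> [[g /is_solutionP gE gC]|[g /is_solutionP gE /is_solutionP gT]].
  exists (g \o lshift _); apply/is_solutionP => w wI.
    by rewrite -word_value_rename gE // mem_cat map_f ?orbT.
  rewrite ab_word_value.
  have /tnthP[j ->] : w \in in_tuple (ab_theta I) by [].
  have [L ML /(recognised_derived ML) gj] := gC _ _ (rec_instance_rshift j).
  have : word_value (fun s : S => val s) g (witnessed_eqn j) = 1.
    by rewrite gE // mem_cat mem_rev map_f ?mem_enum.
  (* The equation identifies the value of the word of [Theta] with the new variable, which [ab]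
     kills. *)
  by rewrite witnessed_eqn_value => /mulg1_eq <-; rewrite invgK.
(* The new equations force this choice: each new variable takes the value of its word of [Theta]. *)
pose h i := match fintype.split i with
  | inl i' => g i'
  | inr j =>
      word_value (fun s : S => val s) g (tnth (in_tuple (ab_theta I)) j)
  end.
have hl : h \o lshift _ = g.
  by apply/funext => i; rewrite /h /= -[lshift _ i]/(unsplit (inl i)) unsplitK.
have hr j : h (rshift _ j) =
    word_value (fun s : S => val s) g (tnth (in_tuple (ab_theta I)) j).
  by rewrite /h -[rshift _ j]/(unsplit (inr j)) unsplitK.
exists h; first apply/is_solutionP => w.
  rewrite mem_cat mem_rev => /orP[/mapP[j _ ->]|/mapP[u uI ->]].
    by rewrite witnessed_eqn_value hl hr mulVg.
  by rewrite word_value_rename hl gE.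
move=> i N; case: (split_ordP i) => j ->; first by rewrite rec_instance_lshift.
rewrite rec_instance_rshift => -[<-]; exists [set x | ab x = 1] => //=.
by rewrite hr -ab_word_value gT // (mem_tnth j (in_tuple (ab_theta I))).
Qed.

(** * The translation as a WHILE program *)

Local Open Scope nat_scope.

(* Variable 1 counts the variables, 2 collects the equations, 3 runs through
   [Theta], 4 collects the constraints and 5 counts down the old variables. *)
Definition theta_loop : cmd :=
  CWhile (EVar 3)
    (CSeq (CAssign 2 (ECons
        (ECons (ECons (EConst (code_bool true))
                  (ECons (EConst (code_bool true)) (EVar 1)))
           (EHead (EVar 3)))
        (EVar 2)))
    (CSeq (CAssign 1 (ECons (EConst Leaf) (EVar 1)))
    (CSeq (CAssign 4
        (ECons (EConst (code_option (@code_dfa S) (Some M))) (EVar 4)))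
      (CAssign 3 (ETail (EVar 3)))))).

Definition free_loop : cmd :=
  CWhile (EVar 5)
    (CSeq (CAssign 4 (ECons (EConst Leaf) (EVar 4)))
      (CAssign 5 (ETail (EVar 5)))).

(** The list of constraints is built from its end: first those of the new variables, then the empty
    ones of the old variables. *)
Definition reduction_program : cmd :=
  CSeq (CAssign 1 (EHead (EVar 0)))
  (CSeq (CAssign 5 (EHead (EVar 0)))
  (CSeq (CAssign 2 (EHead (ETail (EVar 0))))
  (CSeq (CAssign 3 (ETail (ETail (EVar 0))))
  (CSeq theta_loop
  (CSeq free_loop
    (CQuery 0 (ECons (EVar 1) (ECons (EVar 2) (EVar 4))))))))).

Definition witness_code (p : nat * tree) : tree :=
  Node (Node (code_bool true) (Node (code_bool true) (code_nat p.1))) p.2.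

(** Induction on [s] with arbitrary counter and accumulators. Each pass uses the counter as the
    number of the new variable before incrementing it. *)
Lemma exec_theta_loop (O : oracle) (s : seq tree) (n : nat) (st : store) :
  st 3 = code_seq id s -> st 1 = code_nat n ->
  exists2 st', exec O theta_loop st st' &
    [/\ st' 1 = code_nat (n + size s),
        st' 2 = foldl (fun e t => Node t e) (st 2)
                  (map witness_code (zip (iota n (size s)) s)),
        st' 4 = iter (size s) (Node (code_option (@code_dfa S) (Some M))) (st 4)
      & st' 5 = st 5].
Proof.
elim: s n st => [|t s IH] n st st3 st1.
  by exists st; [exact: exec_while_false | rewrite addn0].
(* The stores after each of the four assignments of one pass. *)
set st1' := update st 2 (Node (witness_code (n, t)) (st 2)).
set st2' := update st1' 1 (code_nat n.+1).
set st3' := update st2' 4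
  (Node (code_option (@code_dfa S) (Some M)) (st 4)).
set st4' := update st3' 3 (code_seq id s).
have [st' Hst' [e1 e2 e4 e5]] := IH n.+1 st4' erefl erefl.
exists st'; last first.
  split; rewrite ?e1 ?e2 ?e4 ?e5 ?addSnnS //.
  by rewrite iterSr.
apply: exec_while_true Hst'; first by rewrite /= st3.
apply: (@exec_seq _ _ _ _ st1').
  have -> : st1' = update st 2 (eval st (ECons
      (ECons (ECons (EConst (code_bool true))
         (ECons (EConst (code_bool true)) (EVar 1))) (EHead (EVar 3)))
      (EVar 2))) by rewrite /= st1 st3.
  exact: exec_assign.
apply: (@exec_seq _ _ _ _ st2').
  have -> : st2' = update st1' 1 (eval st1' (ECons (EConst Leaf) (EVar 1))).
    by rewrite /= /st1' /update /= st1.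
  exact: exec_assign.
apply: (@exec_seq _ _ _ _ st3'); first exact: exec_assign.
have -> : st4' = update st3' 3 (eval st3' (ETail (EVar 3))).
  by rewrite /= /st3' /st2' /st1' /update /= st3.
exact: exec_assign.
Qed.

Lemma exec_free_loop (O : oracle) (n : nat) (st : store) :
  st 5 = code_nat n ->
  exists2 st', exec O free_loop st st' &
    [/\ st' 1 = st 1, st' 2 = st 2 & st' 4 = iter n (Node Leaf) (st 4)].
Proof.
elim: n st => [|n IH] st st5.
  by exists st; first exact: exec_while_false.
set st1' := update st 4 (Node Leaf (st 4)).
set st2' := update st1' 5 (code_nat n).
have [st' Hst' [e1 e2 e4]] := IH st2' erefl.
exists st'; last by rewrite e1 e2 e4 iterSr.
apply: exec_while_true Hst'; first by rewrite /= st5.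
apply: (@exec_seq _ _ _ _ st1'); first exact: exec_assign.
have -> : st2' = update st1' 5 (eval st1' (ETail (EVar 5))).
  by rewrite /= /st1' /update /= st5.
exact: exec_assign.
Qed.

Lemma code_seq_nseq (A : Type) (f : A -> tree) (n : nat) (x : A) (s : seq A) :
  code_seq f (nseq n x ++ s) = iter n (Node (f x)) (code_seq f s).
Proof. by elim: n => //= n ->. Qed.

Lemma code_seq_map (A B : Type) (f : B -> tree) (h : A -> B) (s : seq A) :
  code_seq f (map h s) = code_seq (f \o h) s.
Proof. by rewrite /code_seq foldr_map. Qed.

Lemma code_seq_rev_cat (A : Type) (f : A -> tree) (s t : seq A) :
  code_seq f (rev s ++ t) =
  foldl (fun e u => Node u e) (code_seq f t) (map f s).
Proof. by elim: s t => //= x s IH t; rewrite rev_cons cat_rcons IH. Qed.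

(** The right-hand side is assembled from the final contents of variables 1, 2 and 4, as the two
    loop lemmas describe them. *)
Lemma code_rec_instance_of I :
  code_rec_instance (rec_instance_of I) =
  Node (code_nat (ab_vars I + size (ab_theta I)))
    (Node (foldl (fun e t => Node t e)
             (code_seq (@code_eqn G S _) (ab_eqns I))
             (map witness_code
               (zip (iota (ab_vars I) (size (ab_theta I)))
                  (map (@code_eqn G S _) (ab_theta I)))))
       (iter (ab_vars I) (Node Leaf)
          (iter (size (ab_theta I))
             (Node (code_option (@code_dfa S) (Some M))) Leaf))).
Proof.
rewrite /code_rec_instance /=; congr (Node _ (Node _ _)); last first.
  by rewrite code_seq_nseq -[nseq (size _) _]cats0 code_seq_nseq.
rewrite code_seq_rev_cat code_seq_map; congr foldl.
  rewrite /code_seq; elim: (ab_eqns I) => //= w E ->.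
  by rewrite code_eqn_rename.
set n := size (ab_theta I).
have szip : size (zip (iota (ab_vars I) n) (map (@code_eqn G S _) (ab_theta I)))
    = n by rewrite size_zip size_iota size_map minnn.
have senum : size (map (@witnessed_eqn I) (enum 'I_n)) = n.
  by rewrite size_map size_enum_ord.
(* The lists agree entrywise: [rshift] and [iota] both give the [j]-th new variable the number
   [ab_vars I + j]. *)
apply: (@eq_from_nth _ Leaf) => [|j].
  by rewrite [LHS]size_map [RHS]size_map senum szip.
rewrite size_map senum => jn.
rewrite (nth_map (witnessed_eqn (Ordinal jn))) ?senum //.
rewrite (nth_map (Ordinal jn)) ?size_enum_ord //.
rewrite (nth_map (0, Leaf)) ?szip // nth_zip ?size_iota ?size_map //.
rewrite nth_iota // (nth_map [::]) // (_ : nth _ _ j = Ordinal jn); last first.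
  by apply: val_inj; rewrite /= nth_enum_ord.
by rewrite /witness_code /= code_eqn_rename // (tnth_nth [::]).
Qed.

Lemma reduction_programP (O : oracle) : oracle_solves O (DP_rec S) ->
  program_solves O reduction_program (DP_ab S).
Proof.
move=> O_solves I _.
have [b Ob bE] := O_solves _ (@rec_instance_of_promise I).
exists b; last by rewrite bE; exact: rec_instance_of_answer.
(* The stores before the loops. Variable 4 is still [Leaf], the code of the empty list of
   constraints. *)
set st0 := update (fun=> Leaf) 0 (code_ab_instance I).
set st1 := update st0 1 (code_nat (ab_vars I)).
set st2 := update st1 5 (code_nat (ab_vars I)).
set st3 := update st2 2 (code_seq (@code_eqn G S _) (ab_eqns I)).
set st4 := update st3 3 (code_seq (@code_eqn G S _) (ab_theta I)).
have st43 : st4 3 = code_seq id (map (@code_eqn G S _) (ab_theta I)).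
  by rewrite code_seq_map.
have [st5 H5 [e1 e2 e4 e5]] :=
  exec_theta_loop O st43 (erefl : st4 1 = code_nat (ab_vars I)).
have [st6 H6 [f1 f2 f4]] := exec_free_loop O (e5 : st5 5 = code_nat (ab_vars I)).
exists (update st6 0 (code_bool b)) => //.
apply: (@exec_seq _ _ _ _ st1); first exact: exec_assign.
apply: (@exec_seq _ _ _ _ st2); first exact: exec_assign.
apply: (@exec_seq _ _ _ _ st3); first exact: exec_assign.
apply: (@exec_seq _ _ _ _ st4); first exact: exec_assign.
apply: (exec_seq H5); apply: (exec_seq H6); apply: exec_query.
by rewrite -Ob /= code_rec_instance_of f1 f2 f4 e1 e2 e4 size_map.
Qed.

End Reduction.

Theorem proposition4p2 (G : groupType) (S : {fset G})
  (S_symmetric : forall s, s \in S -> (s^-1)%g \in S)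
  (S_generates : generated_subgroup [set` S]%classic = [set: G]%classic)
  (ab_finite : finite_set [set: abelianisation G]%classic) :
  reducible (DP_ab S) (DP_rec S).
Proof.
(* The program may depend on [G] and [S], so the automaton is built into it as a constant. *)
exists (reduction_program (derived_dfa S ab_finite)) => O.
apply: reduction_programP; first exact: derived_dfa_recognises.
exact: word_proj_surj.
Qed.
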